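(* Let $\mathcal X$ be a measurable space, $\Phi=\{g_1,\dots,g_d\}$ a finite nonempty set of real-valued measurable functions on $\mathcal X$, $\mathcal P$ the hypothesis generated by $\Phi$, and $\mathcal E$ the set of e-variables for $\mathcal P$. Let $\mathcal Q$ be an alternative hypothesis, $U$ a utility function, $\chi$ a penalty function, and $\mathbb U$ the associated objective function on $\mathcal E$, as specified in the context. Assume that $$\int_{\mathcal X}(|g_1|+\cdots+|g_d|)\,d\mathsf Q<\infty\quad\text{for all }\mathsf Q\in\mathcal Q.$$ Then there exists an e-variable $h^*=1+\sum_{i=1}^d\pi_i^*g_i$ with $\pi^*\in K_0$ that achieves the supremum $\sup_{h\in\mathcal E}\mathbb U(h)$.
   Context: The hypothesis generated by $\Phi$ is the set $\mathcal P$ of probability measures $\mu$ on $\mathcal X$ with $\int|f|\,d\mu<\infty$ and $\int f\,d\mu\le 0$ for all $f\in\Phi$. A measurable set $A$ is $\mathcal P$-negligible if $\mu(A)=0$ for all $\mu\in\mathcal P$; a property holds $\mathcal P$-q.s. if the set where it fails is $\mathcal P$-negligible (similarly for $\mathcal Q$). An e-variable for $\mathcal P$ is a measurable $h:\mathcal X\to[0,\infty]$ with $\int h\,d\mu\le 1$ for all $\mu\in\mathcal P$. Alternative hypothesis: a family $\mathcal Q$ of probability measures on $\mathcal X$ such that every $\mathcal P$-negligible set is $\mathcal Q$-negligible. Utility function: a nondecreasing upper semicontinuous $U:[0,\infty)\to[-\infty,\infty)$ for which there exist $a\in\mathbb R$, $b>0$ with $U(x)\le a+bx$ for all $x\in[0,\infty)$.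 Penalty function: an arbitrary $\chi:\mathcal Q\to\mathbb R$. Objective: $$\mathbb U(h)=\inf_{\mathsf Q\in\mathcal Q}\Big\{\int_{\mathcal X}U(h)\,d\mathsf Q-\chi(\mathsf Q)\Big\},\quad h\in\mathcal E,$$ with the convention that the integral is $-\infty$ whenever $\int U(h)^-\,d\mathsf Q=\infty$. (E-variables are finite $\mathcal P$-q.s., hence $\mathcal Q$-q.s., so $U(h)$ is defined $\mathcal Q$-q.s.) The support of $\rho\in\mathbb R^d_+=[0,\infty)^d$ is $\mathrm{supp}(\rho)=\{i:\rho_i>0\}$. An index set $I\subset\{1,\dots,d\}$ is redundant if there exists a nonzero $\rho\in\mathbb R^d_+$ with $\mathrm{supp}(\rho)\subset I$ and $\sum_{i=1}^d\rho_ig_i=0$, $\mathcal P$-q.s. Set $K=\{\pi\in\mathbb R^d_+:\mathrm{supp}(\pi)\text{ is not redundant}\}$, $\Pi^\Phi=\{\pi\in\mathbb R^d_+:1+\sum_{i=1}^d\pi_ig_i\ge 0\ \ \mathcal P\text{-q.s.}\}$, and $K_0=K\cap\Pi^\Phi$.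
   Formalization: The identity h* = 1 + Σ π*_i g_i is asserted P-quasi-surely rather than at every point, since for π* in K_0 the right-hand side is only guaranteed nonnegative P-q.s. and can be negative on a P-negligible set. *)

(* Defs.v *)
From mathcomp Require Import all_boot all_order all_algebra.
From mathcomp Require Import all_classical all_reals all_analysis.
From mathcomp Require Import measurable_realfun.

Set Implicit Arguments.
Unset Strict Implicit.
Unset Printing Implicit Defensive.

Import Order.TTheory GRing.Theory Num.Theory.
Import numFieldNormedType.Exports.

Local Open Scope classical_set_scope.
Local Open Scope ring_scope.
Local Open Scope ereal_scope.

Section hypotheses.
Context {disp : measure_display} {X : measurableType disp} {R : realType}.
Implicit Types P Q : set (probability X R).

Definition generated_hypothesis (Phi : set (X -> R)) : set (probability X R) :=
  [set mu : probability X R | forall f, Phi f ->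
     mu.-integrable [set: X] (EFin \o f) /\ \int[mu]_x (f x)%:E <= 0].

(* Unlike the library's [mu.-negligible], this requires measurability. *)
Definition negligible_for P (A : set X) : Prop :=
  measurable A /\ forall mu, P mu -> mu A = 0.

Definition quasi_surely P (prop : X -> Prop) : Prop :=
  negligible_for P [set x | ~ prop x].

Definition e_variable P (h : X -> \bar R) : Prop :=
  [/\ measurable_fun [set: X] h,
      forall x, 0 <= h x &
      forall mu, P mu -> \int[mu]_x h x <= 1].

Definition alternative_hypothesis P Q : Prop :=
  forall A : set X, negligible_for P A -> negligible_for Q A.

(* Only the restriction of U to [0, +oo[ is constrained; semicontinuity is
   relative to [0, +oo[. *)
Definition utility_function (U : R -> \bar R) : Prop :=
  [/\ forall x : R, (0 <= x)%R -> U x < +oo,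
      forall x y : R, (0 <= x)%R -> (x <= y)%R -> U x <= U y,
      forall x : R, (0 <= x)%R -> forall c : R, U x < c%:E ->
        \forall y \near x, (0 <= y)%R -> U y < c%:E &
      exists a b : R, (0 < b)%R /\
        forall x : R, (0 <= x)%R -> U x <= (a + b * x)%:E].

(* U(h) is defined only where h is finite, so it is integrated over that set;
   for e-variables its complement is P-negligible, hence null for the
   alternative. In the library, the integral of f is
   \int f^\+ - \int f^\- with +oo - +oo = -oo, so it is -oo as soon as
   \int f^\- = +oo. *)
Definition expected_utility (U : R -> \bar R) (h : X -> \bar R)
    (mu : probability X R) : \bar R :=
  \int[mu]_(x in [set x | h x < +oo]) U (fine (h x)).

(* The penalty chi matters only through its values on Q. *)
Definition objective Q (U : R -> \bar R) (chi : probability X R -> R)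
    (h : X -> \bar R) : \bar R :=
  ereal_inf [set expected_utility U h mu - (chi mu)%:E | mu in Q].

End hypotheses.

Section constraints.
Context {disp : measure_display} {X : measurableType disp} {R : realType}.
Context {d : nat}.
Implicit Types (P : set (probability X R)) (g : 'I_d -> X -> R).

Definition nonneg_orthant : set 'rV[R]_d :=
  [set v : 'rV[R]_d | forall i, (0 <= v 0%R i)%R].

Definition supp (v : 'rV[R]_d) : {set 'I_d} := [set i | (0 < v 0 i)%R]%SET.

Definition redundant P g (I : {set 'I_d}) : Prop :=
  exists rho : 'rV[R]_d,
    [/\ nonneg_orthant rho, rho != 0%R, supp rho \subset I &
        quasi_surely P (fun x => \sum_(i < d) rho 0 i * g i x = 0)%R].

Definition nonredundant_cone P g : set 'rV[R]_d :=
  [set pi | nonneg_orthant pi /\ ~ redundant P g (supp pi)].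

Definition feasible_set P g : set 'rV[R]_d :=
  [set pi | nonneg_orthant pi /\
    quasi_surely P (fun x => 0 <= 1 + \sum_(i < d) pi 0 i * g i x)%R].

Definition K0 P g : set 'rV[R]_d := nonredundant_cone P g `&` feasible_set P g.

End constraints.

(* Main.v *)
Require Import Defs.
From HB Require Import structures.
From mathcomp Require Import all_boot all_order all_algebra.
From mathcomp Require Import all_classical all_reals all_analysis.
From mathcomp Require Import measurable_realfun ring lra.

(** Every e-variable [h] is dominated, quasi-surely, by some [1 + sum_i pi_i g_i]
    with [pi >= 0]. Restrict to the set [Y] where all quasi-surely vanishing
    nonnegative combinations of the [g_i] vanish; its complement is negligible.
    The points [(g x, s)] with [x] in [Y] and [s + 1 <= h x], the rays [(e_i, 0)]
    for the coordinates [i] unused by those combinations, and [(0, -1)] generate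
    a convex cone that does not contain [(0, 1)]: otherwise a normalized
    finitely supported measure would lie in the hypothesis and integrate [h]
    to more than 1. A functional that separates properly cannot be vertical,
    because a vertical one would be (up to a shift by a vanishing combination) a
    nonnegative combination that is nonnegative on [Y], hence vanishing, so the
    functional would be zero on the whole cone. Its slope is the required [pi].

    Subtracting quasi-surely vanishing combinations moves [pi] into [K0] without
    changing the e-variable. [K0] is compact: it is closed since it is cut out
    of finitely many faces of the orthant, and the normalized limit of an
    unbounded sequence would witness the redundancy of the supports. Finally
    [pi |-> int U (1 + pi g) dQ] is upper semicontinuous by the reverse Fatou
    lemma, with the integrable bound [a + b (1 + M sum_i |g_i|)], and so is the
    infimum over [Q]; a limit point of a maximizing sequence is optimal. *)

Set Implicit Arguments.
Unset Strict Implicit.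
Unset Printing Implicit Defensive.

Import Order.TTheory GRing.Theory Num.Theory.
Import numFieldNormedType.Exports.

Local Open Scope classical_set_scope.
Local Open Scope ring_scope.

(** * Separation of convex cones *)

Section convex_cones.
Context {R : realType}.

Definition convex_cone n (E : set 'rV[R]_n) : Prop :=
  [/\ E 0, forall u v, E u -> E v -> E (u + v) &
      forall a u, 0 <= a -> E u -> E (a *: u)].

(** Choose a subspace [W] of maximal rank such that [E + W], called [F] below, is not the whole
    space; [W = 0] qualifies. A point outside [F] replaces [u]. Maximality forces [W] and [u] to
    span, and a functional with kernel [W] and value -1 at [u] is nonnegative on [E]. *)
Lemma cone_supporting_functional n (E : set 'rV[R]_n) (u : 'rV[R]_n) :
  convex_cone E -> ~ E u ->
  exists m : 'cV[R]_n, m != 0 /\ forall v, E v -> 0 <= (v *m m) 0 0.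
Proof.
move=> [E0 ED EZ] Eu.
pose avoids (W : 'M[R]_n) :=
  exists z : 'rV[R]_n, forall w : 'rV_n, (w <= W)%MS -> ~ E (z - w).
pose Pr (r : nat) := `[< exists W, \rank W = r /\ avoids W >].
have exr : exists r, Pr r.
  exists 0%N; apply/asboolP; exists 0; split; first by rewrite mxrank0.
  by exists u => w; rewrite submx0 => /eqP ->; rewrite subr0.
have ubr r : Pr r -> (r <= n)%N.
  by move=> /asboolP[W [<- _]]; exact: rank_leq_row.
case: (ex_maxnP exr ubr) => r /asboolP[W [rW [{Eu}u uW]]] maxr.
pose F (v : 'rV[R]_n) := exists2 w : 'rV_n, (w <= W)%MS & E (v - w).
have FD v w : F v -> F w -> F (v + w).
  move=> [x xW Ex] [y yW Ey]; exists (x + y); first exact: addmx_sub.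
  by rewrite opprD addrACA; exact: ED.
have FZ a v : 0 <= a -> F v -> F (a *: v).
  move=> a0 [x xW Ex]; exists (a *: x); first exact: scalemx_sub.
  by rewrite -scalerBr; exact: EZ.
have FW w : (w <= W)%MS -> F w by move=> wW; exists w; rewrite ?subrr.
have Fu : ~ F u by move=> [w wW]; exact: uW.
have uNW : ~~ (u <= W)%MS by apply/negP => /FW.
have full (z y : 'rV_n) : ~~ (z <= W)%MS -> exists a, F (y + a *: z).
  move=> zW; apply: contrapT => nF.
  have /maxr : Pr (\rank (W + z)%MS).
    apply/asboolP; exists (W + z)%MS; split => //.
    exists y => w /sub_addsmxP[[x1 x2] /= ->] Ey; apply: nF.
    have /sub_rVP[a xa] : (x2 *m z <= z)%MS by exact: submxMl.
    exists (- a); exists (x1 *m W); first exact: submxMl.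
    by move: Ey; rewrite xa opprD addrA addrAC scaleNr.
  rewrite -rW leqNgt => /negP; apply; apply: rank_ltmx.
  rewrite ltmxE addsmxSl /=; apply/negP => /(submx_trans (addsmxSr _ _)).
  exact/negP.
have line (w : 'rV_n) : exists t, ((w + t *: u)%R <= W)%MS.
  apply: contrapT => nt.
  have {}nt t : ~~ ((w + t *: u)%R <= W)%MS by apply/negP => h; apply: nt; exists t.
  (* Two uses of [full] along [u] make [S] nonempty and bounded above. A third, from [u] in the
     direction [w + sup S *: u], gives a coefficient [a]: [a = 0] puts [u] in [F], [a > 0] gives a
     member of [S] above [sup S], and [a < 0] an upper bound below it. *)
  pose S := [set t | F (w + t *: u)].
  have S0 : S !=set0 by have [a Fa] := full u w uNW; exists a.
  have ubS b : F (- w + b *: u) -> ubound S (- b).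
    move=> Fb t St; rewrite -subr_ge0 leNgt; apply/negP => tb; apply: Fu.
    have tb0 : 0 < t + b by lra.
    have := FZ (t + b)^-1 _ _ (FD _ _ St Fb).
    rewrite addrACA subrr add0r -scalerDl scalerA mulVf ?scale1r ?gt_eqF//.
    by apply; rewrite invr_ge0 ltW.
  have supS : has_sup S.
    by split => //; have [b Fb] := full u (- w) uNW; exists (- b); exact: ubS.
  have [a] := full _ u (nt (sup S)).
  have [a0|a0|->] := ltgtP a 0; last by rewrite scale0r addr0.
    have a0' : 0 < - a by rewrite oppr_gt0.
    have ai : 0 <= (- a)^-1 by rewrite invr_ge0 ltW.
    move=> /(FZ _ _ ai).
    have -> : (- a)^-1 *: (u + a *: (w + sup S *: u)) =
        - w + ((- a)^-1 - sup S) *: u.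
      rewrite scalerDr scalerA invrN mulNr mulVf ?lt_eqF// scaleN1r opprD.
      by rewrite addrCA -scaleNr -scalerDl.
    move=> /ubS ub; have := ge_sup S0 ub; rewrite opprB.
    by rewrite lerDl oppr_ge0 invr_le0 => /le_gtF; rewrite a0'.
  have ai : 0 <= a^-1 by rewrite invr_ge0 ltW.
  move=> /(FZ _ _ ai).
  have -> : a^-1 *: (u + a *: (w + sup S *: u)) = w + (sup S + a^-1) *: u.
    rewrite scalerDr scalerA mulVf ?gt_eqF// scale1r addrC -addrA.
    by rewrite -scalerDl.
  move=> /(ub_le_sup supS.2); rewrite gerDl invr_le0 => /le_gtF.
  by rewrite a0.
have [j cj] : exists j, (u *m cokermx W) 0 j != 0.
  apply: contrapT => nj; move/negP: uNW; apply; rewrite submxE; apply/eqP.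
  apply/rowP => j; rewrite [RHS]mxE; apply/eqP/negP => h.
  by apply: nj; exists j; apply/negP.
set c := (u *m cokermx W) 0 j in cj.
pose m : 'cV_n := - c^-1 *: col j (cokermx W).
have um : (u *m m) 0 0 = -1.
  rewrite -scalemxAr colE mulmxA -colE 2!mxE -/c.
  by rewrite mulNr mulVf.
exists m; split.
  apply/eqP => m0; move: um; rewrite m0 mulmx0 mxE => /eqP.
  by rewrite eq_sym oppr_eq0 oner_eq0.
move=> v Ev; have [t vt] := line v.
have -> : (v *m m) 0 0 = t.
  have : ((v + t *: u) *m m) 0 0 = 0.
    move: vt; rewrite submxE => /eqP vt.
    by rewrite -scalemxAr colE mulmxA vt mul0mx scaler0 mxE.
  by rewrite mulmxDl -scalemxAl mxE [X in _ + X]mxE um mulrN1 => /subr0_eq.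
(* A negative [t] would put [u = (- t)^-1 *: (v - (v + t *: u))] in [F]. *)
rewrite leNgt; apply/negP => t0; apply: Fu.
have t0' : 0 <= (- t)^-1 by rewrite invr_ge0 oppr_ge0 ltW.
have Fv : F v by exists 0; rewrite ?sub0mx ?subr0.
have := FZ _ _ t0' (FD _ _ Fv (FW _ _)).
move=> /(_ (- (v + t *: u))); rewrite (eqmx_opp (v + t *: u)) => /(_ vt).
rewrite opprD addrA subrr add0r -scaleNr scalerA mulVf ?scale1r//.
by rewrite oppr_eq0 lt_eqF.
Qed.

(** A linearly independent family in [E] of maximal length. Its rows belong to [E] itself, so they
    inherit properties such as nonnegativity. *)
Lemma spanning_rows n (E : set 'rV[R]_n) :
  exists r (B : 'M[R]_(r, n)), [/\ row_free B, forall k, E (row k B) &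
    forall v, E v -> (v <= B)%MS].
Proof.
pose Pr (r : nat) := `[< exists B : 'M[R]_(r, n),
  row_free B /\ forall k, E (row k B) >].
have exr : exists r, Pr r.
  exists 0%N; apply/asboolP; exists 0; split; last by case.
  by rewrite /row_free mxrank0.
have ubr r : Pr r -> (r <= n)%N.
  by move=> /asboolP[B [/eqP rB _]]; rewrite -rB rank_leq_col.
case: (ex_maxnP exr ubr) => r /asboolP[B [fB EB]] maxr.
exists r, B; split => // v Ev; apply: contrapT => /negP vB.
have /maxr : Pr (r + 1)%N.
  apply/asboolP; exists (col_mx B v); split.
    rewrite /row_free eqn_leq rank_leq_row /= [leqLHS]addn1.
    rewrite -addsmxE -[ltnLHS](eqP fB); apply: rank_ltmx; rewrite ltmxE addsmxSl /=.
    by apply: contra vB => /(submx_trans (addsmxSr _ _)).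
  move=> k; case: (splitP k) => j kj.
    by have -> : k = lshift 1 j by [exact: val_inj]; rewrite rowKu.
  have -> : k = rshift r j by exact: val_inj.
  by rewrite rowKd row_id.
by rewrite addn1 ltnn.
Qed.

(** Generated one term at a time, so that induction can turn an element into the list of atoms of a
    measure. *)
Inductive conic_hull n (S : set 'rV[R]_n) : set 'rV[R]_n :=
| conic_hull0 : conic_hull S 0
| conic_hullD a s v : 0 <= a -> S s -> conic_hull S v ->
    conic_hull S (a *: s + v).

Lemma convex_cone_conic_hull n (S : set 'rV[R]_n) : convex_cone (conic_hull S).
Proof.
split; first exact: conic_hull0.
  move=> u v; elim=> [|a s w a0 Ss _ IH] hv; first by rewrite add0r.
  by rewrite -addrA; apply: conic_hullD => //; exact: IH.
move=> a u a0; elim=> [|b s w b0 Ss _ IH].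
  by rewrite scaler0; exact: conic_hull0.
by rewrite scalerDr scalerA; apply: conic_hullD => //; exact: mulr_ge0.
Qed.

Lemma conic_hull_gen n (S : set 'rV[R]_n) s : S s -> conic_hull S s.
Proof.
move=> Ss; rewrite -[s]addr0 -[s]scale1r.
by apply: conic_hullD => //; exact: conic_hull0.
Qed.

(* Working in coordinates on the linear span of the cone turns a nonzero
   functional into one that does not vanish on the generators. *)
Lemma conic_proper_separation n (S : set 'rV[R]_n) (u : 'rV[R]_n) :
  S u -> ~ conic_hull S (- u) ->
  exists m : 'cV[R]_n, (forall s, S s -> 0 <= (s *m m) 0 0) /\
    exists2 s, S s & 0 < (s *m m) 0 0.
Proof.
move=> Su hNu; have [r [B [fB SB SsubB]]] := spanning_rows S.
have [C0 CD CZ] := convex_cone_conic_hull S.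
pose E := [set c : 'rV_r | conic_hull S (c *m B)].
have cE : convex_cone E.
  split=> [|c c' /= Ec Ec'|a c a0 Ec]; rewrite /E /=.
  - by rewrite mul0mx.
  - by rewrite mulmxDl; exact: CD.
  - by rewrite -scalemxAl; exact: CZ.
have /submxP[c uc] := SsubB _ Su.
have Ec : ~ E (- c) by rewrite /E /= mulNmx -uc.
have [m [m0 mE]] := cone_supporting_functional cE Ec.
(* As [B] is row free, [pinvmx B] extends [m] from coordinates to the ambient space; the value at
   [row k B], itself a generator, is [m k 0]. *)
have Bm : B *m (pinvmx B *m m) = m by rewrite mulmxA mulmxVp// mul1mx.
exists (pinvmx B *m m); split.
  move=> s Ss; have /submxP[e se] := SsubB _ Ss.
  rewrite se -mulmxA Bm; apply: mE.
  by rewrite /E /= -se; exact: conic_hull_gen.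
have [k mk] : exists k, m k 0 != 0.
  apply: contrapT => nk; move/eqP: m0; apply; apply/matrixP => k j.
  rewrite ord1 [RHS]mxE; apply/eqP/negP => h; apply: nk; exists k.
  exact/negP.
exists (row k B) => //.
rewrite -row_mul Bm mxE lt_neqAle eq_sym mk /=.
have := mE (delta_mx 0 k); rewrite -rowE mxE; apply.
by rewrite /E /= -rowE; exact: conic_hull_gen.
Qed.

End convex_cones.

(** * Finitely supported measures and the generated hypothesis *)

Section quasi_sure.
Context {disp : measure_display} {X : measurableType disp} {R : realType}.
Implicit Types P : set (probability X R).

Lemma quasi_surely_and P (p q : X -> Prop) :
  quasi_surely P p -> quasi_surely P q -> quasi_surely P (fun x => p x /\ q x).
Proof.
move=> [mp p0] [mq q0]; rewrite /quasi_surely.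
have -> : [set x | ~ (p x /\ q x)] = [set x | ~ p x] `|` [set x | ~ q x].
  by apply/seteqP; split=> x /=; rewrite not_andE.
split; first exact: measurableU.
move=> mu Pmu; have mup := p0 _ Pmu; have muq := q0 _ Pmu.
by rewrite (measureU0 mp mq muq).
Qed.

Lemma quasi_surely_all P (p : X -> Prop) : (forall x, p x) -> quasi_surely P p.
Proof.
move=> px; rewrite /quasi_surely; have -> : [set x | ~ p x] = set0.
  by rewrite -subset0 => x /(_ (px x)).
by split=> // mu _; rewrite measure0.
Qed.

Lemma quasi_surely_forall P (I : countType) (p : I -> X -> Prop) :
  (forall i, quasi_surely P (p i)) -> quasi_surely P (fun x => forall i, p i x).
Proof.
move=> qp; pose F n := [set x | if unpickle n is Some i then ~ p i x else False].
have qF n : negligible_for P (F n).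
  rewrite /F; case: (unpickle n) => [i|]; first exact: qp.
  by split=> [|mu _]; [exact: measurable0|exact: measure0].
rewrite /quasi_surely.
have -> : [set x | ~ (forall i, p i x)] = \bigcup_n F n.
  apply/seteqP; split=> x /=.
    by move=> /existsNP[i npi]; exists (pickle i) => //; rewrite /F /= pickleK.
  move=> [n _]; rewrite /F /=; case: (unpickle n) => // i npi h; exact: npi.
split; first by apply: bigcup_measurable => n _; exact: (qF n).1.
move=> mu Pmu; apply/negligibleP.
  by apply: bigcup_measurable => n _; exact: (qF n).1.
apply: negligible_bigcup => n.
by apply/negligibleP; [exact: (qF n).1|exact: (qF n).2].
Qed.

Lemma quasi_surelyW P (p q : X -> Prop) : measurable [set x | ~ q x] ->
  (forall x, p x -> q x) -> quasi_surely P p -> quasi_surely P q.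
Proof.
move=> mq pq [mp p0]; split=> // mu Pmu.
apply/eqP; rewrite eq_le measure_ge0 andbT -(p0 _ Pmu).
by apply: le_measure; rewrite ?inE// => x /=; apply: contra_not => /pq.
Qed.

End quasi_sure.

Section probability_of_measure.
Context {disp : measure_display} {X : measurableType disp} {R : realType}.
Variables (m : {measure set X -> \bar R}) (m1 : m setT = 1%E).

(** Carrying the proof of unit mass in an alias lets a probability structure be attached to it. *)
Definition prob_of_measure of m setT = 1%E : set X -> \bar R := m.

HB.instance Definition _ := Measure.on (prob_of_measure m1).
HB.instance Definition _ :=
  Measure_isProbability.Build _ _ _ (prob_of_measure m1) m1.

End probability_of_measure.

Section finitely_supported.
Context {disp : measure_display} {X : measurableType disp} {R : realType}.
Implicit Types l : seq ({nonneg R} * X).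

Lemma finitely_supported_measure l : exists m : {measure set X -> \bar R},
  forall f : X -> \bar R, measurable_fun setT f -> (forall x, 0 <= f x)%E ->
    (\int[m]_x f x = \sum_(a <- l) a.1%:num%:E * f a.2)%E.
Proof.
elim: l => [|[a x] l [m IH]].
  by exists mzero => f _ _; rewrite big_nil integral_measure_zero.
exists (measure_add (mscale a (dirac x)) m) => f mf f0.
rewrite ge0_integral_measure_add// ge0_integral_mscale// integral_dirac//.
by rewrite diracT mul1e IH// big_cons.
Qed.

Lemma finitely_supported_probability l :
  (0 < \sum_(a <- l) a.1%:num) ->
  exists mu : probability X R,
  [/\ forall f : X -> \bar R, measurable_fun setT f -> (forall x, 0 <= f x)%E ->
      (\int[mu]_x f x = (\sum_(a <- l) a.1%:num)^-1%:E *
                        \sum_(a <- l) a.1%:num%:E * f a.2)%E,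
      forall f : X -> R, measurable_fun setT f ->
        mu.-integrable setT (EFin \o f) &
      forall f : X -> R, measurable_fun setT f ->
      (\int[mu]_x (f x)%:E = ((\sum_(a <- l) a.1%:num)^-1 *
                        \sum_(a <- l) a.1%:num * f a.2)%:E)%E].
Proof.
set t := \sum_(a <- l) _ => t0.
have ti0 : 0 <= t^-1 by rewrite invr_ge0 ltW.
have [m mE] := finitely_supported_measure l.
pose n := mscale (NngNum ti0) m.
have nE (f : X -> \bar R) : measurable_fun setT f -> (forall x, 0 <= f x)%E ->
    (\int[n]_x f x = t^-1%:E * \sum_(a <- l) a.1%:num%:E * f a.2)%E.
  by move=> mf f0; rewrite ge0_integral_mscale// mE.
have n1 : (n setT = 1)%E.
  have := nE (cst 1%E) (measurable_cst _) (fun=> lee01).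
  rewrite integral_cst// mul1e => h; apply: (etrans h).
  under eq_bigr do rewrite mule1.
  by rewrite sumEFin -EFinM mulVf// gt_eqF.
pose mu : probability X R := prob_of_measure n1.
have muE (f : X -> \bar R) : measurable_fun setT f -> (forall x, 0 <= f x)%E ->
    (\int[mu]_x f x = t^-1%:E * \sum_(a <- l) a.1%:num%:E * f a.2)%E.
  exact: nE.
have muR (f : X -> R) : measurable_fun setT f -> (forall x, 0 <= f x) ->
    (\int[mu]_x (f x)%:E = (t^-1 * \sum_(a <- l) a.1%:num * f a.2)%:E)%E.
  move=> mf f0; rewrite muE//; last exact/measurable_EFinP.
  by under eq_bigr do rewrite -EFinM; rewrite sumEFin.
have imu (f : X -> R) : measurable_fun setT f -> mu.-integrable setT (EFin \o f).
  move=> mf; apply/integrableP; split; first exact/measurable_EFinP.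
  under eq_integral do rewrite /=.
  by rewrite muR ?ltry//; exact: measurableT_comp.
exists mu; split=> // f mf.
have fE : f = f^\+ \- f^\- by exact/esym/funrposBneg.
have mfp : measurable_fun setT f^\+ by exact: measurable_funrpos.
have mfn : measurable_fun setT f^\- by exact: measurable_funrneg.
rewrite {1}fE; under eq_integral do rewrite EFinB.
rewrite integralB_EFin//; last 2 first.
- by apply: imu.
- by apply: imu.
rewrite (muR _ mfp)// (muR _ mfn)//.
rewrite -EFinB -mulrBr -sumrB; congr ((_ * _)%:E); apply: eq_bigr => a _.
by rewrite -mulrBr [in RHS]fE.
Qed.
End finitely_supported.

(** * Linear combinations of the constraints *)

Section lincomb.
Context {disp : measure_display} {X : measurableType disp} {R : realType}.
Context {d : nat}.
Variable g : 'I_d -> X -> R.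
Hypothesis mg : forall i, measurable_fun [set: X] (g i).
Implicit Types v : 'rV[R]_d.

Definition lincomb v (x : X) : R := \sum_(i < d) v 0 i * g i x.

Lemma lincombD u v x : lincomb (u + v) x = lincomb u x + lincomb v x.
Proof.
by rewrite /lincomb -big_split; apply: eq_bigr => i _; rewrite mxE mulrDl.
Qed.

Lemma lincombZ a v x : lincomb (a *: v) x = a * lincomb v x.
Proof.
by rewrite /lincomb mulr_sumr; apply: eq_bigr => i _; rewrite mxE mulrA.
Qed.

Lemma lincomb0 x : lincomb 0 x = 0.
Proof. by rewrite -(scale0r (0 : 'rV_d)) lincombZ mul0r. Qed.

Lemma lincomb_mulmx r (e : 'rV[R]_r) (B : 'M[R]_(r, d)) x :
  lincomb (e *m B) x = \sum_k e 0 k * lincomb (row k B) x.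
Proof.
rewrite mulmx_sum_row; elim/big_rec2: _ => [|k y v _ <-].
  by rewrite lincomb0.
by rewrite lincombD lincombZ.
Qed.

Lemma measurable_lincomb v : measurable_fun setT (lincomb v).
Proof.
by apply: measurable_sum => i; apply: measurable_funM => //; exact: measurable_cst.
Qed.

Lemma measurable_lincomb_neq0 v : measurable [set x | ~ lincomb v x = 0].
Proof.
rewrite (_ : [set x | _] = ~` (lincomb v @^-1` [set 0])); last by [].
by apply: measurableC; rewrite -[X in measurable X]setTI; exact: measurable_lincomb.
Qed.

Lemma measurable_lincomb_lt (c : R) v : measurable [set x | ~ 0 <= c + lincomb v x].
Proof.
rewrite (_ : [set x | _] = lincomb v @^-1` `]-oo, - c[%classic).
  by rewrite -[X in measurable X]setTI; exact: measurable_lincomb.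
apply/seteqP; split=> x /=; rewrite in_itv /=.
  by move=> /negP; rewrite -ltNge => h; lra.
by move=> h1; apply/negP; rewrite -ltNge; lra.
Qed.

Let P : set (probability X R) := generated_hypothesis (range g).

Lemma lincomb_integral v mu : nonneg_orthant v -> P mu ->
  mu.-integrable setT (EFin \o lincomb v) /\
  (\int[mu]_x (lincomb v x)%:E <= 0)%E.
Proof.
move=> v0 Pmu.
have gi i : mu.-integrable setT (EFin \o g i) /\ (\int[mu]_x (g i x)%:E <= 0)%E.
  by apply: Pmu; exists i.
have lE : EFin \o lincomb v = (fun x => \sum_(i < d) (v 0 i)%:E * (g i x)%:E)%E.
  by apply/funext => x /=; rewrite /lincomb -sumEFin.
have ivg i : mu.-integrable setT (fun x => (v 0 i)%:E * (g i x)%:E)%E.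
  by apply: integrableZl => //; exact: (gi i).1.
rewrite lE; split; first exact: integrable_sum.
have -> : (\int[mu]_x (lincomb v x)%:E =
    \sum_(i < d) \int[mu]_x ((v 0 i)%:E * (g i x)%:E))%E.
  rewrite -integral_sum//; apply: eq_integral => x _.
  by rewrite -[LHS]/((EFin \o _) x) lE.
apply: sume_le0 => i _; rewrite integralZl//; last exact: (gi i).1.
by apply: mule_ge0_le0; [rewrite lee_fin; exact: v0|exact: (gi i).2].
Qed.

(** The integral is at most 0 under every member of [P], so an almost everywhere nonnegative
    integrand vanishes almost everywhere. This serves both to exclude vertical functionals and to
    bound [K0]. *)
Lemma lincomb_nonneg_eq0 v : nonneg_orthant v ->
  quasi_surely P (fun x => 0 <= lincomb v x) ->
  quasi_surely P (fun x => lincomb v x = 0).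
Proof.
move=> v0 [mN N0]; split; first exact: measurable_lincomb_neq0.
move=> mu Pmu.
have [il l0] := lincomb_integral v0 Pmu.
have ge0 : {ae mu, forall x, 0 <= lincomb v x}.
  by exists [set x | ~ 0 <= lincomb v x]; split => //; exact: N0.
have posE : (\int[mu]_x (lincomb v x)%:E = \int[mu]_x `|(lincomb v x)%:E|)%E.
  apply: ae_eq_integral => //.
  - exact: measurable_int il.
  - by apply: measurableT_comp => //; exact: measurable_int il.
  - by apply: filterS ge0 => x lx _; rewrite gee0_abs.
have /ae_eq_integral_abs : (\int[mu]_x `|(EFin \o lincomb v) x| = 0)%E.
  apply/eqP; rewrite eq_le -{1}posE l0 /=.
  exact: integral_ge0.
move=> /(_ measurableT (measurable_int _ il)) [N [mN' muN sN]].
have mA := measurable_lincomb_neq0 v.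
apply/eqP; rewrite eq_le measure_ge0 andbT -muN.
apply: le_measure; rewrite ?inE//.
by move=> x /= nx; apply: sN => /= /(_ I) [].
Qed.

End lincomb.

(** * Domination of e-variables *)

Section domination.
Context {disp : measure_display} {X : measurableType disp} {R : realType}.
Context {d : nat}.
Variable g : 'I_d -> X -> R.
Hypothesis mg : forall i, measurable_fun [set: X] (g i).

Let P : set (probability X R) := generated_hypothesis (range g).

(** A large multiple of [b] compensates the negative entries of [r]. In the sum of the ratios [t i],
    an index with [b 0 i = 0] contributes 0, the default value of the division. *)
Lemma nonneg_orthant_shift (r b : 'rV[R]_d) : nonneg_orthant b ->
  (forall i, b 0 i = 0 -> 0 <= r 0 i) ->
  exists2 k, 0 <= k & nonneg_orthant (r + k *: b).
Proof.
move=> b0 rb; pose t i := `|r 0 i| / b 0 i.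
have t0 i : 0 <= t i by rewrite divr_ge0// b0.
exists (\sum_i t i); first exact: sumr_ge0.
move=> i; rewrite !mxE; have := b0 i; rewrite le_eqVlt => /orP[/eqP bi0|bi0].
  by rewrite -bi0 mulr0 addr0; exact: rb.
rewrite (bigD1 i)//= mulrDl divfK ?gt_eqF// addrA.
apply: addr_ge0; last by rewrite mulr_ge0 ?sumr_ge0 1?ltW.
by rewrite -lerBlDl sub0r ler_normr lexx orbT.
Qed.

(** For positive [t], normalizing the weights by their total [T] would give a member of [P] under
    which [h] integrates to at least [1 + t / T]. If [T = 0], all weights vanish and the bound
    itself reads [t <= 0]. *)
Lemma e_variable_finitely_supported h (l : seq ({nonneg R} * X)) (t : R) :
  e_variable P h -> (forall i, \sum_(a <- l) a.1%:num * g i a.2 <= 0) ->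
  (t%:E + (\sum_(a <- l) a.1%:num)%:E <=
    \sum_(a <- l) a.1%:num%:E * h a.2)%E ->
  t <= 0.
Proof.
move=> [mh h0 hP] lg tl; rewrite leNgt; apply/negP => t0.
set T := \sum_(a <- l) a.1%:num in tl.
have : 0 <= T by exact: sumr_ge0.
rewrite le_eqVlt => /orP[/eqP T0|T0].
  have z a : a \in l -> a.1%:num = 0.
    move=> al; apply/eqP; move: T0 => /esym/eqP; rewrite psumr_eq0//.
    by move=> /allP/(_ _ al).
  move: tl; rewrite -T0 adde0 big1_seq; last first.
    by move=> a /= /z ->; rewrite mul0e.
  by rewrite lee_fin leNgt t0.
have [mu [muE mui muR]] := finitely_supported_probability T0.
have Pmu : P mu.
  move=> _ [i _ <-]; split; first exact: mui.
  by rewrite muR// lee_fin; apply: mulr_ge0_le0; [rewrite invr_ge0 ltW|exact: lg].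
have := hP _ Pmu; rewrite muE// -/T => h1.
have : (T^-1%:E * (t%:E + T%:E) <= 1)%E.
  by apply: le_trans h1; apply: lee_wpmul2l => //; rewrite lee_fin invr_ge0 ltW.
rewrite -EFinD -EFinM lee_fin mulrDr mulVf ?gt_eqF// gerDr leNgt.
by rewrite mulr_gt0// invr_gt0.
Qed.

Let gvec x : 'rV[R]_d := \row_i g i x.

(** The last coordinate records the excess of [h] over 1, which turns the affine bound
    [1 + lincomb g pi] into a linear one; letting [s] range over reals accommodates infinite values
    of [h]. *)
Let gens h (Y : set X) (b : 'rV[R]_d) : set 'rV[R]_(d + 1) :=
  [set z | [\/ exists x s, [/\ Y x, (s%:E + 1 <= h x)%E &
                              z = row_mx (gvec x) s%:M],
               exists2 i, b 0 i = 0 & z = row_mx (delta_mx 0 i) 0 |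
               z = row_mx 0 (-1)%:M]].

(** Generators of the first kind supply the atoms of [l], and [t] sums their weighted heights; the
    other two kinds only raise one of the first [d] coordinates or lower the last one. *)
Let conic_hull_gens h Y b z : conic_hull (gens h Y b) z ->
  exists (l : seq ({nonneg R} * X)) (t : R),
  [/\ (t%:E + (\sum_(a <- l) a.1%:num)%:E <=
        \sum_(a <- l) a.1%:num%:E * h a.2)%E,
      forall i, \sum_(a <- l) a.1%:num * g i a.2 <= z 0 (lshift 1 i) &
      z 0 (rshift d 0) <= t].
Proof.
elim=> [|a s v a0 Ss _ [l [t [tl lg vt]]]].
  exists [::], 0; split=> [|i|]; rewrite ?big_nil ?mxE//.
  by rewrite adde0.
case: Ss => [[x [s' [Yx sh ->]]]|[i _ ->]|->].
- exists ((NngNum a0, x) :: l), (a * s' + t); split.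
  + rewrite !big_cons /=.
    have -> : ((a * s' + t)%:E + (a + \sum_(j <- l) (j.1)%:num)%:E =
       a%:E * (s'%:E + 1) + (t%:E + (\sum_(a <- l) a.1%:num)%:E))%E.
      by rewrite -!EFinD; congr EFin; ring.
    by apply: leeD => //; apply: lee_wpmul2l.
  + move=> i; rewrite big_cons mxE [X in _ <= X + _]mxE row_mxEl mxE /=.
    by rewrite lerD2l.
  + by rewrite mxE [X in X + _ <= _]mxE row_mxEr mxE eqxx mulr1n lerD2l.
- exists l, t; split=> //.
  + move=> j; apply: le_trans (lg j) _; rewrite [leRHS]mxE lerDr.
    by rewrite mxE row_mxEl mxE mulr_ge0.
  + by rewrite mxE [X in X + _]mxE row_mxEr mxE mulr0 add0r.
- exists l, t; split=> //.
  + move=> j; apply: le_trans (lg j) _; rewrite [leRHS]mxE lerDr.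
    by rewrite mxE row_mxEl mxE mulr0.
  + apply: le_trans vt; rewrite mxE gerDr mxE row_mxEr mxE eqxx mulr1n.
    by rewrite mulrN1 oppr_le0.
Qed.

Lemma e_variable_dominated h : e_variable P h ->
  exists pi : 'rV[R]_d, nonneg_orthant pi /\
    exists2 Y : X -> Prop, quasi_surely P Y &
      forall x, Y x -> (h x <= (1 + lincomb g pi x)%:E)%E.
Proof.
move=> eh; have [mh h0 hP] := eh.
pose M := [set rho : 'rV[R]_d | nonneg_orthant rho /\
  quasi_surely P (fun x => lincomb g rho x = 0)].
have [r [B [_ BM MB]]] := spanning_rows M.
(* The sum of the rows of [B]. As these are nonnegative and span [M], [b 0 i = 0] means that
   coordinate [i] vanishes throughout [M]. *)
pose b : 'rV[R]_d := const_mx 1 *m B.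
have B0 k i : 0 <= B k i by have := (BM k).1 i; rewrite mxE.
have bE i : b 0 i = \sum_k B k i.
  by rewrite mxE; apply: eq_bigr => k _; rewrite mxE mul1r.
have b0 : nonneg_orthant b by move=> i; rewrite bE sumr_ge0.
pose Y := [set x | forall k, lincomb g (row k B) x = 0].
have qY : quasi_surely P Y by apply: quasi_surely_forall => k; exact: (BM k).2.
have Yb x : Y x -> lincomb g b x = 0.
  by move=> Yx; rewrite lincomb_mulmx big1// => k _; rewrite Yx mulr0.
have [||m [mge [z gz mz]]] :=
  @conic_proper_separation R (d + 1) (gens h Y b) (row_mx 0 (-1)%:M).
- exact: Or33.
- move=> /conic_hull_gens[l [t [tl lg]]].
  rewrite mxE row_mxEr mxE eqxx mulr1n opprK => t1.
  have : t <= 0.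
    apply: e_variable_finitely_supported eh _ tl => i.
    by apply: le_trans (lg i) _; rewrite mxE row_mxEl mxE oppr0.
  by move=> /(le_trans t1); rewrite ler10.
pose rho := (usubmx m)^T; pose c := (dsubmx m) 0 0.
have mE (v : 'rV[R]_d) (w : 'M[R]_1) : (row_mx v w *m m) 0 0 =
    \sum_i v 0 i * rho 0 i + w 0 0 * c.
  rewrite -[in LHS](vsubmxK m) mul_row_col mxE; congr (_ + _).
    by rewrite mxE; apply: eq_bigr => i _; rewrite [rho _ _]mxE.
  by rewrite mxE big_ord1.
have gE x : \sum_i gvec x 0 i * rho 0 i = lincomb g rho x.
  by apply: eq_bigr => i _; rewrite mxE mulrC.
have dE i : \sum_j (delta_mx 0 i : 'rV[R]_d) 0 j * rho 0 j = rho 0 i.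
  rewrite (bigD1 i)//= big1 ?addr0; last first.
    by move=> j ji; rewrite mxE (negbTE ji) andbF mul0r.
  by rewrite mxE !eqxx mul1r.
have m1 x s : Y x -> (s%:E + 1 <= h x)%E -> 0 <= lincomb g rho x + s * c.
  move=> Yx sh; have := mge (row_mx (gvec x) s%:M).
  rewrite mE gE [s%:M _ _]mxE eqxx mulr1n; apply.
  by apply: Or31; exists x, s.
have m2 i : b 0 i = 0 -> 0 <= rho 0 i.
  move=> bi; have := mge (row_mx (delta_mx 0 i) 0).
  rewrite mE dE [X in _ + X * _]mxE mul0r addr0; apply.
  by apply: Or32; exists i.
have z1 : (row_mx 0 (-1)%:M *m m) 0 0 = - c.
  rewrite mE big1 ?add0r; last by move=> i _; rewrite mxE mul0r.
  by rewrite mxE eqxx mulr1n mulN1r.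
have c0 : c <= 0.
  by rewrite -oppr_ge0 -z1; apply: mge; exact: Or33.
have [k k0 rk] := nonneg_orthant_shift b0 m2.
have cN0 : c != 0.
  (* The vertical case. Taking [s = -1], allowed since [h >= 0], gives [lincomb g rho >= 0] on [Y];
     then [rho + k *: b] lies in [M], hence in the span of [B], and the functional vanishes on all
     generators, against [mz]. *)
  apply/eqP => cz.
  have MR : M (rho + k *: b).
    split=> //; apply: lincomb_nonneg_eq0 => //.
    apply: quasi_surelyW qY.
      have := measurable_lincomb_lt mg 0 (rho + k *: b); congr (measurable _).
      by apply/seteqP; split=> x /=; rewrite add0r.
    move=> x Yx; rewrite lincombD lincombZ Yb// mulr0 addr0.
    have := m1 x (-1) Yx; rewrite cz mulr0 addr0; apply.
    by rewrite -EFinD addNr h0.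
  have /submxP[e eE] := MB _ MR.
  move: mz; case: gz => [[x [s [Yx _ ->]]]|[i bi ->]|->].
  - rewrite mE cz mulr0 addr0 gE.
    suff -> : lincomb g rho x = 0 by rewrite ltxx.
    have : lincomb g (rho + k *: b) x = 0.
      by rewrite eE lincomb_mulmx big1// => j _; rewrite Yx mulr0.
    by rewrite lincombD lincombZ Yb// mulr0 addr0.
  - rewrite mE dE cz mulr0 addr0.
    suff -> : rho 0 i = 0 by rewrite ltxx.
    have : (rho + k *: b) 0 i = 0.
      rewrite eE mxE big1// => j _.
      move: (bi); rewrite bE => /eqP; rewrite psumr_eq0//.
      move=> /allP/(_ j); rewrite mem_index_enum => /(_ isT)/eqP ->.
      by rewrite mulr0.
    by rewrite mxE [X in _ + X]mxE bi mulr0 addr0.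
  - by rewrite z1 cz oppr0 ltxx.
have nc : 0 < - c by rewrite oppr_gt0 lt_neqAle cN0.
exists ((- c)^-1 *: (rho + k *: b)); split.
  by move=> i; rewrite mxE mulr_ge0 ?rk// invr_ge0 ltW.
exists Y => // x Yx; rewrite lincombZ lincombD lincombZ Yb// mulr0 addr0.
have bound s : (s%:E + 1 <= h x)%E -> s <= (- c)^-1 * lincomb g rho x.
  move=> /(m1 _ _ Yx) hs; rewrite ler_pdivlMl//; lra.
case hx : (h x) (h0 x) => [s| |//] _.
  rewrite lee_fin -lerBlDl; apply: bound; rewrite hx -EFinD lee_fin; lra.
set q := (- c)^-1 * _ in bound *.
have : q + 1 <= q by apply: bound; rewrite hx leey.
by rewrite gerDl ler10.
Qed.

End domination.

(** * Compactness of the reduced feasible set *)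

(** [phi n] is an index at least [n] whose term lies within [1 / (n + 1)] of a cluster point;
    [n <= phi n] is what the tail arguments below use. *)
Lemma rV_bolzano_weierstrass (R : realType) d (M : R) (u : nat -> 'rV[R]_d) :
  (forall n i, `|u n 0 i| <= M) ->
  exists (phi : nat -> nat) (p : 'rV[R]_d), (forall n, (n <= phi n)%N) /\
    forall i, u (phi n) 0 i @[n --> \oo] --> p 0 i.
Proof.
move=> uM.
have cA : compact [set v : 'rV[R]_d | forall i, `[- M, M]%classic (v ord0 i)].
  by apply: (@rV_compact R d (fun=> `[- M, M]%classic)) => i; exact: segment_compact.
have [|p [_ clp]] := cA (u @ \oo) _.
  exists 0%N => // n _ i /=.
  by rewrite in_itv /= -ler_norml uM.
have ex n : exists m, (n <= m)%N /\ ball p n.+1%:R^-1 (u m).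
  have [||_ [[m nm <-] um]] :=
      clp [set u m | m in [set m | (n <= m)%N]] (ball p n.+1%:R^-1).
  - by exists n => // m nm; exists m.
  - exact: nbhsx_ballx.
  - by exists m.
have [phi phiP] := choice ex.
exists phi, p; split=> [n|i]; first exact: (phiP n).1.
apply/cvgrPdist_lt => e e0.
have := near_infty_natSinv_lt (PosNum e0); apply: filterS => n /= ne.
by apply: lt_trans ne; exact: (phiP n).2.2.
Qed.

Section optimal_cone.
Context {disp : measure_display} {X : measurableType disp} {R : realType}.
Context {d : nat}.
Variable g : 'I_d -> X -> R.
Hypothesis mg : forall i, measurable_fun [set: X] (g i).

Lemma lincomb_cvg (u : nat -> 'rV[R]_d) (p : 'rV[R]_d) x :
  (forall i, u n 0 i @[n --> \oo] --> p 0 i) ->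
  lincomb g (u n) x @[n --> \oo] --> lincomb g p x.
Proof.
move=> up; apply: (cvg_big (F := \oo) (@add_continuous R)) => i _.
by apply: cvgM; [exact: up|exact: cvg_cst].
Qed.

Lemma redundant_sub (P : set (probability X R)) (I J : {set 'I_d}) :
  I \subset J -> redundant P g I -> redundant P g J.
Proof.
move=> IJ [rho [r0 rn rI rq]]; exists rho; split=> //.
exact: fintype.subset_trans rI IJ.
Qed.

(** Induction on the size of the support. Given a witness [rho] of redundancy, subtract [t *: rho]
    with [t] the smallest ratio [v 0 i / rho 0 i] over [supp rho]: entries stay nonnegative and the
    minimizing one leaves the support. *)
Lemma feasible_reduction (P : set (probability X R)) (v : 'rV[R]_d) :
  feasible_set P g v -> exists2 w, K0 P g w &
    quasi_surely P (fun x => lincomb g w x = lincomb g v x).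
Proof.
have [n] := ubnP #|supp v|; elim: n v => // n IH v vn fv.
have [rd|nrd] := pselect (redundant P g (supp v)); last first.
  exists v; first by split=> //; split=> //; case: fv.
  exact: quasi_surely_all.
have [v0 vq] := fv; have [rho [r0 rn rs rq]] := rd.
have [i0 ri0] : exists i, 0 < rho 0 i.
  apply: contrapT => nr; move/eqP: rn; apply; apply/rowP => i; rewrite [RHS]mxE.
  apply/eqP; rewrite eq_le r0 andbT leNgt; apply/negP => h.
  by apply: nr; exists i.
case: (arg_minP (P := fun i => 0 < rho 0 i) (fun i => v 0 i / rho 0 i) ri0)
  => j rj jmin.
pose t := v 0 j / rho 0 j.
have t0 : 0 <= t by rewrite divr_ge0// v0.
pose w := v + (- t) *: rho.
have wE i : w 0 i = v 0 i - t * rho 0 i by rewrite !mxE mulNr.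
have w0 : nonneg_orthant w.
  move=> i; rewrite wE subr_ge0; have := r0 i; rewrite le_eqVlt => /orP[/eqP <-|ri].
    by rewrite mulr0 v0.
  by rewrite -ler_pdivlMr// jmin.
have wv : quasi_surely P (fun x => lincomb g w x = lincomb g v x).
  apply: quasi_surelyW rq.
    have := measurable_lincomb_neq0 mg ((- t) *: rho); congr (measurable _).
    apply/seteqP; split=> x /=; rewrite lincombD; apply: contra_not => h.
      by move: h => /eqP; rewrite -subr_eq0 addrC addKr => /eqP.
    by rewrite h addr0.
  by move=> x rx; rewrite lincombD lincombZ [lincomb g rho x]rx mulr0 addr0.
have [||w' Kw' ww'] := IH w.
- rewrite -ltnS; apply: leq_trans vn; rewrite ltnS.
  have vj : 0 < v 0 j.
    by have := fintype.subsetP rs j; rewrite !inE; apply.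
  apply: proper_card; apply/properP; split.
    apply/fintype.subsetP => i; rewrite !inE wE => h; apply: lt_le_trans h _.
    by rewrite gerDl oppr_le0 mulr_ge0.
  exists j; rewrite !inE// wE /t divfK ?gt_eqF// subrr ltxx//.
- split=> //; have := quasi_surely_and wv vq; apply: quasi_surelyW.
    exact: measurable_lincomb_lt.
  by move=> x [h1 h2]; rewrite [X in 1 + X]h1.
exists w' => //; have := quasi_surely_and ww' wv; apply: quasi_surelyW.
  have := measurable_lincomb_neq0 mg (w' + (- 1) *: v); congr (measurable _).
  apply/seteqP; split=> x /=; rewrite lincombD lincombZ mulN1r; apply: contra_not.
    by move=> ->; rewrite subrr.
  by move=> /eqP; rewrite subr_eq0 => /eqP.
by move=> x [-> ->].
Qed.

Let P : set (probability X R) := generated_hypothesis (range g).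

(** Entries positive in the limit are eventually positive, so [supp p] lies in some nonredundant
    [supp (u N)]. Feasibility passes to the limit outside a countable union of negligible sets. *)
Lemma K0_closed (u : nat -> 'rV[R]_d) (p : 'rV[R]_d) : (forall n, K0 P g (u n)) ->
  (forall i, u n 0 i @[n --> \oo] --> p 0 i) -> K0 P g p.
Proof.
move=> Ku up.
have p0 : nonneg_orthant p.
  move=> i; apply: cvgr_to_ge (up i) _; apply: nearW => n.
  exact: (Ku n).1.1.
have [N _ Np] : \forall n \near \oo, supp p \subset supp (u n).
  have : \forall n \near \oo, forall i : 'I_d, 0 < p 0 i -> 0 < u n 0 i.
    apply: filter_forall => i; have [pi|pi] := ltP 0 (p 0 i); last by apply: nearW.
    by near=> n => _; near: n; apply: cvgr_gt (up i) _ pi.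
  by apply: filterS => n h; apply/fintype.subsetP => i; rewrite !inE; exact: h.
split; first split=> //.
  by move=> /(redundant_sub (Np N (leqnn N))); exact: (Ku N).1.2.
split=> //; have := quasi_surely_forall (fun n => (Ku n).2.2).
apply: quasi_surelyW; first exact: measurable_lincomb_lt.
move=> x ux; rewrite -/(lincomb g p x).
have l1 : 1 + lincomb g (u n) x @[n --> \oo] --> 1 + lincomb g p x.
  by apply: cvgD; [exact: cvg_cst|exact: lincomb_cvg].
apply: cvgr_to_ge l1 _.
by apply: nearW => n; exact: ux.
Unshelve. all: by end_near. Qed.

(** Normalize an unbounded sequence to coordinate sum 1, with subsequential limit [p]. Dividing
    feasibility by the sums [s n] gives [lincomb g p >= 0] quasi-surely, hence equality by
    [lincomb_nonneg_eq0]; so [p] makes the support of some [u (phi N)] redundant. *)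
Lemma K0_bounded : exists M, forall v, K0 P g v -> forall i, v 0 i <= M.
Proof.
apply: contrapT => nb.
have ex n : exists v : 'rV[R]_d, K0 P g v /\ n.+1%:R < \sum_i v 0 i.
  apply: contrapT => nv; apply: nb; exists n.+1%:R => v Kv i.
  rewrite leNgt; apply/negP => ni; apply: nv; exists v; split=> //.
  apply: lt_le_trans ni _; rewrite (bigD1 i)//= lerDl sumr_ge0// => j _.
  exact: Kv.1.1.
have [u uP] := choice ex.
have u0 n i : 0 <= u n 0 i by exact: (uP n).1.1.1.
pose s n := \sum_i u n 0 i.
have ns n : n.+1%:R < s n by exact: (uP n).2.
have s0 n : 0 < s n by apply: le_lt_trans (ns n).
pose eta n := (s n)^-1 *: u n.
have eta0 n i : 0 <= eta n 0 i by rewrite mxE mulr_ge0// invr_ge0 ltW.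
have eta1 n : \sum_i eta n 0 i = 1.
  under eq_bigr do rewrite mxE; rewrite -mulr_sumr mulVf// gt_eqF//.
have [|phi [p [phin etap]]] := @rV_bolzano_weierstrass R d 1 eta.
  move=> n i; rewrite ger0_norm// -(eta1 n) (bigD1 i)//= lerDl sumr_ge0//.
have p0 : nonneg_orthant p.
  by move=> i; apply: cvgr_to_ge (etap i) _; apply: nearW.
have p1 : \sum_i p 0 i = 1.
  have : \sum_i eta (phi n) 0 i @[n --> \oo] --> \sum_i p 0 i.
    by apply: (cvg_big (F := \oo) (@add_continuous R)) => i _; exact: etap.
  under eq_fun do rewrite eta1.
  by move=> /cvg_lim <- //; rewrite lim_cst.
have [N _ Np] : \forall n \near \oo, supp p \subset supp (u (phi n)).
  have : \forall n \near \oo, forall i : 'I_d, 0 < p 0 i -> 0 < eta (phi n) 0 i.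
    apply: filter_forall => i; have [pi|pi] := ltP 0 (p 0 i); last by apply: nearW.
    by near=> n => _; near: n; apply: cvgr_gt (etap i) _ pi.
  apply: filterS => n h; apply/fintype.subsetP => i; rewrite !inE => /h.
  by rewrite mxE pmulr_rgt0 ?invr_gt0.
apply: (uP (phi N)).1.1.2; apply: redundant_sub (Np N (leqnn N)) _.
exists p; split=> //.
  by apply/eqP => pz; move: p1; rewrite pz big1 => [/eqP|i _]; rewrite ?mxE// eq_sym oner_eq0.
apply: lincomb_nonneg_eq0 => //.
have := quasi_surely_forall (fun n => (uP n).1.2.2).
apply: quasi_surelyW.
  have := measurable_lincomb_lt mg 0 p; congr (measurable _).
  by apply/seteqP; split=> x /=; rewrite add0r.
move=> x ux.
have si : (s (phi n))^-1 @[n --> \oo] --> (0 : R).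
  apply: (@squeeze_cvgr _ _ _ _ (cst 0) (@harmonic R)).
  - apply: nearW => n; rewrite /= invr_ge0 (ltW (s0 _)) /= lef_pV2 ?posrE//.
    by apply: ltW; apply: le_lt_trans (ns _); rewrite ler_nat ltnS.
  - exact: cvg_cst.
  - exact: cvg_harmonic.
rewrite -[lincomb _ _ _]add0r.
have l1 : (s (phi n))^-1 + lincomb g (eta (phi n)) x @[n --> \oo] -->
    0 + lincomb g p x.
  by apply: cvgD => //; exact: lincomb_cvg.
apply: cvgr_to_ge l1 _.
apply: nearW => n; rewrite lincombZ -[X in X + _]mulr1 -mulrDr mulr_ge0//.
  by rewrite invr_ge0 ltW.
exact: ux.
Unshelve. all: by end_near. Qed.

End optimal_cone.

(** * Reverse Fatou lemma *)

Section integrals.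
Local Open Scope ereal_scope.
Context {disp : measure_display} {X : measurableType disp} {R : realType}.

(** Preimages of the rays [[c, +oo]] are upward closed, hence intervals. *)
Lemma nondecreasing_measurable_ereal (F : R -> \bar R) :
  {homo F : x y / (x <= y)%R >-> x <= y} -> measurable_fun setT F.
Proof.
move=> ndF; apply: (measurability _ (ErealGenCInfty.measurableE R)) => //.
move=> _ [_ [c ->] <-]; rewrite setTI; apply: is_interval_measurable.
move=> x y /=; rewrite !in_itv /= !andbT => cx cy z /andP[xz zy].
rewrite in_itv /= andbT; exact: le_trans cx (ndF _ _ xz).
Qed.

Variable mu : {measure set X -> \bar R}.

Lemma ae_le_integral (f h : X -> \bar R) :
  measurable_fun setT f -> measurable_fun setT h ->
  {ae mu, forall x, f x <= h x} -> \int[mu]_x f x <= \int[mu]_x h x.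
Proof.
move=> mf mh fh; rewrite integralE [leRHS]integralE; apply: leeB.
  apply: ae_ge0_le_integral => //; [exact: measurable_funepos..|].
  apply: filterS fh => x fx _; rewrite !funeposE ge_max le_max.
  by rewrite le_max fx lexx orbT.
apply: ae_ge0_le_integral => //; [exact: measurable_funeneg..|].
apply: filterS fh => x fx _; rewrite !funenegE ge_max le_max.
by rewrite le_max leeN2 fx lexx orbT.
Qed.

(** The integral of [f] may be [-oo], so additivity is applied to the nonnegative pieces [G - f^\+]
    and [f^\-]. *)
Lemma integral_dominated_sub (G : X -> R) (f : X -> \bar R) :
  mu.-integrable setT (EFin \o G) -> (forall x, 0 <= G x)%R ->
  measurable_fun setT f -> (forall x, f x <= (G x)%:E) ->
  \int[mu]_x ((G x)%:E - f x) = \int[mu]_x (G x)%:E - \int[mu]_x f x.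
Proof.
move=> iG G0 mf fG.
have mG : measurable_fun setT (EFin \o G) by exact: measurable_int iG.
have fpG x : f^\+ x <= (G x)%:E by rewrite funeposE ge_max fG lee_fin G0.
have ifp : mu.-integrable setT f^\+.
  apply: le_integrable iG => //; first exact: measurable_funepos.
  move=> x _; rewrite gee0_abs ?funepos_ge0// /= ger0_norm//.
have -> : \int[mu]_x ((G x)%:E - f x) = \int[mu]_x (((G x)%:E - f^\+ x) + f^\- x).
  apply: eq_integral => x _; rewrite [in LHS](funeposneg f) /=.
  have : f^\+ x \is a fin_num.
    by rewrite ge0_fin_numE ?funepos_ge0//; apply: le_lt_trans (fpG x) _; rewrite ltry.
  move: (f^\+ x) (f^\- x) (funeneg_ge0 f x) => [r| |]// [s| |]// _ _.
  by rewrite -!EFinB -EFinD; congr EFin; ring.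
rewrite ge0_integralD//; last 3 first.
- by move=> x _; rewrite sube_ge0 ?fpG//; apply/orP; right.
- by apply: emeasurable_funB => //; exact: measurable_funepos.
- exact: measurable_funeneg.
rewrite integralB// (integralE _ _ f).
have := integrable_fin_num measurableT iG.
have := integrable_fin_num measurableT ifp.
have : 0 <= \int[mu]_x f^\- x by apply: integral_ge0 => x _; exact: funeneg_ge0.
rewrite /=.
move: (\int[mu]_x f^\- x) (\int[mu]_x f^\+ x) (\int[mu]_x (G x)%:E).
move=> [r| |]// [s| |]// [t| |]// _ _ _.
by rewrite -!EFinB -!EFinD; congr EFin; ring.
Qed.

Lemma le_ereal_real (l m : \bar R) :
  (forall c : R, c%:E < l -> c%:E <= m) -> l <= m.
Proof.
case: l => [r| |] h; last exact: leNye.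
  apply/lee_subgt0Pr => e e0; rewrite -EFinB; apply: h; rewrite lte_fin; lra.
suff -> : m = +oo by [].
by apply/eqyP => A _; apply: h; rewrite ltry.
Qed.

Lemma limn_einf_ge (u : (\bar R)^nat) (l : \bar R) :
  (forall c : R, c%:E < l -> \forall n \near \oo, c%:E <= u n) ->
  l <= limn_einf u.
Proof.
move=> ul; apply: le_ereal_real => c /ul[N _ Nu].
rewrite limn_einf_lim (cvg_lim _ (@cvg_einfs_sup _ u))//.
apply: le_ereal_sup_tmp; exists (einfs u N); first by exists N.
by apply: le_ereal_inf_tmp => _ [n /= Nn <-]; exact: Nu.
Qed.

(** Fatou's lemma for the nonnegative functions [G - f_ n]. Real thresholds [e] express that the
    upper limit of [f_ n x] is at most [f x], and a real bound [c] avoids indeterminate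
    differences. *)
Lemma reverse_fatou (G : X -> R) (f_ : nat -> X -> \bar R) (f : X -> \bar R) (c : R) :
  mu.-integrable setT (EFin \o G) -> (forall x, 0 <= G x)%R ->
  (forall n, measurable_fun setT (f_ n)) -> measurable_fun setT f ->
  (forall n x, f_ n x <= (G x)%:E) -> (forall x, f x <= (G x)%:E) ->
  (forall x (e : R), f x < e%:E -> \forall n \near \oo, f_ n x <= e%:E) ->
  (forall n, c%:E <= \int[mu]_x f_ n x) -> c%:E <= \int[mu]_x f x.
Proof.
move=> iG G0 mf_ mf f_G fG usc cf.
have mG : measurable_fun setT (EFin \o G) by exact: measurable_int iG.
pose H n x := (G x)%:E - f_ n x.
have Gfin : \int[mu]_x (G x)%:E \is a fin_num by exact: integrable_fin_num iG.
have : \int[mu]_x ((G x)%:E - f x) <= \int[mu]_x (G x)%:E - c%:E.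
  apply: (@le_trans _ _ (\int[mu]_x limn_einf (H^~ x))).
    apply: ge0_le_integral => //.
    - by move=> x _; rewrite sube_ge0 ?fG//; apply/orP; right.
    - exact: emeasurable_funB.
    - apply: (measurableT_comp (f := -%E)) => //.
      apply: (@measurable_fun_limn_esup _ _ _ _ (fun n x => - H n x)) => n.
      by apply: measurableT_comp => //; exact: emeasurable_funB.
    - move=> x _; apply: limn_einf_ge => e eGf.
      have /usc : f x < (G x - e)%:E.
        by move: eGf; case: (f x) => [r| |]//; rewrite -?EFinB ?ltNyr// !lte_fin; lra.
      apply: filterS => n; rewrite /H; case: (f_ n x) => [r| |]//.
        by rewrite -!EFinB !lee_fin; lra.
      by rewrite leey.
  apply: le_trans (fatou _ _ _ _) _ => //.
  - by move=> n; exact: emeasurable_funB.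
  - by move=> n x _; rewrite sube_ge0 ?f_G//; apply/orP; right.
  rewrite limn_einf_lim; apply: lime_le; first exact: is_cvg_einfs.
  apply: nearW => n; apply: ge_ereal_inf.
  exists (\int[mu]_x H n x); first by exists n => /=.
  by rewrite integral_dominated_sub// leeB.
rewrite integral_dominated_sub//.
move: Gfin; case: (\int[mu]_x (G x)%:E) => // t _.
case: (\int[mu]_x f x) => [s| |]//.
  by rewrite -!EFinB !lee_fin => ?; lra.
by rewrite leey.
Qed.
End integrals.

(** * Semicontinuity of the expected utility *)

Section utility.
Context {disp : measure_display} {X : measurableType disp} {R : realType}.
Context {d : nat}.
Variable g : 'I_d -> X -> R.
Hypothesis mg : forall i, measurable_fun [set: X] (g i).

(** Truncation keeps the argument of [U] in its domain at every point; for feasible [v] it alters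
    [1 + lincomb g v] only on a negligible set. *)
Definition wealth (v : 'rV[R]_d) (x : X) : R := Num.max 0 (1 + lincomb g v x).

Lemma wealth_ge0 v x : 0 <= wealth v x.
Proof. by rewrite le_max lexx. Qed.

Lemma measurable_wealth v : measurable_fun setT (wealth v).
Proof.
apply: measurable_maxr; first exact: measurable_cst.
by apply: measurable_funD; [exact: measurable_cst|exact: measurable_lincomb].
Qed.

Lemma wealth_quasi_surely (P : set (probability X R)) v : feasible_set P g v ->
  quasi_surely P (fun x => wealth v x = 1 + lincomb g v x).
Proof.
move=> [_]; congr (quasi_surely P _); apply/funext => x; apply/propext.
by rewrite /wealth -/(lincomb g v x); split=> [/max_idPr|/max_idPr].
Qed.

Lemma wealth_cvg (u : nat -> 'rV[R]_d) (p : 'rV[R]_d) x :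
  (forall i, u n 0 i @[n --> \oo] --> p 0 i) ->
  wealth (u n) x @[n --> \oo] --> wealth p x.
Proof.
move=> up; have l1 : 1 + lincomb g (u n) x @[n --> \oo] --> 1 + lincomb g p x.
  by apply: cvgD; [exact: cvg_cst|exact: lincomb_cvg].
have lip (a b : R) : `|Num.max 0 a - Num.max 0 b| <= `|a - b|.
  rewrite ler_norml; have := ler_norm (a - b).
  have := ler_norm (- (a - b)); rewrite normrN.
  by case: (leP 0 a) => ?; case: (leP 0 b) => ? ? ?; apply/andP; split; lra.
apply/cvgrPdist_lt => e e0; move/cvgrPdist_lt : l1 => /(_ _ e0).
by apply: filterS => n; apply: le_lt_trans; exact: lip.
Qed.

Lemma wealth_bound (v : 'rV[R]_d) (M : R) x : 0 <= M -> (forall i, `|v 0 i| <= M) ->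
  wealth v x <= 1 + M * \sum_i `|g i x|.
Proof.
move=> M0 vM; rewrite ge_max addr_ge0 ?mulr_ge0 ?sumr_ge0//= lerD2l mulr_sumr.
apply: ler_sum => i _; apply: le_trans (ler_norm _) _.
by rewrite normrM ler_wpM2r.
Qed.

Let P : set (probability X R) := generated_hypothesis (range g).

Lemma e_variable_wealth v : feasible_set P g v ->
  e_variable P (fun x => (wealth v x)%:E).
Proof.
move=> fv; split.
- exact/measurable_EFinP/measurable_wealth.
- by move=> x; rewrite lee_fin wealth_ge0.
move=> mu Pmu; have [il l0] := lincomb_integral fv.1 Pmu.
have i1 : mu.-integrable setT (EFin \o cst (1 : R)).
  exact: finite_measure_integrable_cst.
have -> : (\int[mu]_x (wealth v x)%:E = \int[mu]_x (1%:E + (lincomb g v x)%:E))%E.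
  apply: ae_eq_integral => //.
  - exact/measurable_EFinP/measurable_wealth.
  - by apply: emeasurable_funD => //; exact: measurable_int il.
  have [mN N0] := wealth_quasi_surely fv.
  exists [set x | ~ wealth v x = 1 + lincomb g v x]; split=> //; first exact: N0.
  by move=> x /= nx h; apply: nx => _; rewrite h EFinD.
rewrite (integralD _ i1)// [X in (X + _)%E](_ : _ = 1%E); last first.
  by rewrite (integral_cst mu measurableT 1%:E) mul1e; exact: probability_setT.
by rewrite -[leRHS]adde0 leeD2l.
Qed.

Variable U : R -> \bar R.
Hypothesis utilU : utility_function U.

Lemma measurable_utility : measurable_fun setT (fun y : R => U (Num.max 0 y)).
Proof.
have [_ ndU _ _] := utilU.
apply: nondecreasing_measurable_ereal => x y xy; apply: ndU.
  by rewrite le_max lexx.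
by rewrite ge_max !le_max lexx xy orbT.
Qed.

Lemma measurable_utility_wealth v : measurable_fun setT (fun x => U (wealth v x)).
Proof.
have m1 : measurable_fun setT (fun x => 1 + lincomb g v x).
  by apply: measurable_funD; [exact: measurable_cst|exact: measurable_lincomb].
exact: measurableT_comp measurable_utility m1.
Qed.

Lemma expected_utility_wealth v (mu : probability X R) :
  (expected_utility U (fun x => (wealth v x)%:E) mu = \int[mu]_x U (wealth v x))%E.
Proof.
rewrite /expected_utility (_ : [set x | _] = setT)//.
by apply/seteqP; split=> x //= _; rewrite ltry.
Qed.

(** The exceptional set is negligible for [P], hence null for [mu]. Off it [h] is finite, and
    monotonicity of [U] applies. *)
Lemma expected_utility_le (Q : set (probability X R)) (h : X -> \bar R) v mu :
  alternative_hypothesis P Q -> e_variable P h -> Q mu ->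
  quasi_surely P (fun x => (h x <= (1 + lincomb g v x)%:E)%E) ->
  (expected_utility U h mu <= \int[mu]_x U (wealth v x))%E.
Proof.
move=> PQ [mh h0 hP] Qmu hv; have [_ ndU _ _] := utilU.
have [mN /(_ _ Qmu) N0] := PQ _ hv.
pose D := [set x | h x < +oo]%E.
have mD : measurable D by rewrite -[D]setTI; exact: emeasurable_fun_infty_o.
rewrite /expected_utility integral_mkcond; apply: ae_le_integral.
- apply/(measurable_restrictT _ mD).
  rewrite (_ : (fun x => U (fine (h x))) =
      (fun y : R => U (Num.max 0 y)) \o (fine \o h)); last first.
    by apply/funext => x /=; rewrite (max_idPr _)// fine_ge0.
  apply: measurable_funTS; apply: measurableT_comp; first exact: measurable_utility.
  by apply: measurableT_comp.
- exact: measurable_utility_wealth.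
exists [set x | ~ (h x <= (1 + lincomb g v x)%:E)%E]; split=> // x /=.
apply: contra_not => hx.
have Dx : x \in D by rewrite inE /D /=; apply: le_lt_trans hx _; rewrite ltry.
rewrite patchE Dx; apply: ndU; first exact: fine_ge0.
rewrite le_max; apply/orP; right; rewrite -lee_fin fineK//.
by rewrite ge0_fin_numE//; move: Dx; rewrite inE.
Qed.

Lemma expected_utility_usc (mu : probability X R) (u : nat -> 'rV[R]_d)
    (p : 'rV[R]_d) (M c : R) :
  (\int[mu]_x (\sum_(i < d) `|g i x|)%:E < +oo)%E ->
  (forall n i, `|u n 0 i| <= M) ->
  (forall i, u n 0 i @[n --> \oo] --> p 0 i) ->
  (forall n, (c%:E <= \int[mu]_x U (wealth (u n) x))%E) ->
  (c%:E <= \int[mu]_x U (wealth p x))%E.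
Proof.
move=> gmu uM' up cu; have [_ ndU uscU [a [b [b0 Uab]]]] := utilU.
(* For [d = 0] the bound [uM'] leaves the sign of [M] open. *)
pose K := Num.max 0 M.
have K0 : 0 <= K by rewrite le_max lexx.
have uM n i : `|u n 0 i| <= K by rewrite le_max uM' orbT.
have pM i : `|p 0 i| <= K.
  have h : `|u n 0 i| @[n --> \oo] --> `|p 0 i| by apply: cvg_norm; exact: up.
  apply: cvgr_to_le h _.
  by apply: nearW => n; exact: uM.
pose S x := \sum_i `|g i x|.
have mS : measurable_fun setT S.
  by apply: measurable_sum => i; exact: measurableT_comp.
have iS : mu.-integrable setT (EFin \o S).
  apply/integrableP; split; first exact/measurable_EFinP.
  apply: le_lt_trans gmu; apply: ge0_le_integral => //.
  - by apply: measurableT_comp => //; exact/measurable_EFinP.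
  - exact/measurable_EFinP.
  - by move=> x _; rewrite /= ger0_norm// sumr_ge0.
(* [|a|] in place of [a] makes [G] nonnegative, as [reverse_fatou] requires. *)
pose G x := `|a| + b * (1 + K * S x).
have G0 x : 0 <= G x.
  by rewrite addr_ge0// mulr_ge0 ?ltW// ltr_wpDr// mulr_ge0// sumr_ge0.
have UG (v : 'rV[R]_d) x : (forall i, `|v 0 i| <= K) -> (U (wealth v x) <= (G x)%:E)%E.
  move=> vK; apply: le_trans (Uab _ (wealth_ge0 _ _)) _; rewrite lee_fin.
  by apply: lerD; [exact: ler_norm|rewrite ler_pM2l// wealth_bound].
apply: (@reverse_fatou _ _ _ _ G (fun n x => U (wealth (u n) x))) => //.
- have -> : EFin \o G = ((cst (`|a| + b)%:E) \+ (fun x => (b * K)%:E * (S x)%:E))%E.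
    by apply/funext => x /=; rewrite -EFinM -EFinD /G; congr EFin; ring.
  apply: integrableD => //; first exact: finite_measure_integrable_cst.
  exact: integrableZl.
- by move=> n; exact: measurable_utility_wealth.
- exact: measurable_utility_wealth.
- by move=> n x; apply: UG => i; exact: uM.
- by move=> x; apply: UG => i; exact: pM.
move=> x e /(uscU _ (wealth_ge0 p x)) near_e.
have [N _ near_u] := wealth_cvg (x := x) up near_e.
by exists N => // n Nn; exact/ltW/(near_u _ Nn)/wealth_ge0.
Qed.

End utility.

(** * Existence of an optimal e-variable *)

Local Open Scope ereal_scope.

Unset Implicit Arguments.

Theorem theorem7p3 (disp : measure_display) (X : measurableType disp)
    (R : realType) (d : nat) (g : 'I_d -> X -> R)
    (P Q : set (probability X R)) (U : R -> \bar R)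
    (chi : probability X R -> R) :
  (0 < d)%N ->
  (forall i, measurable_fun [set: X] (g i)) ->
  P = generated_hypothesis (range g) ->
  alternative_hypothesis P Q ->
  utility_function U ->
  (forall mu : probability X R, Q mu ->
     \int[mu]_x (\sum_(i < d) `|g i x|)%:E < +oo) ->
  exists (h : X -> \bar R) (pi : 'rV[R]_d),
    [/\ e_variable P h,
        K0 P g pi,
        quasi_surely P (fun x => h x = (1 + \sum_(i < d) pi 0%R i * g i x)%:E) &
        objective Q U chi h =
          ereal_sup [set objective Q U chi h' | h' in e_variable P]].
Proof.
move=> d0 mg -> {P} PQ utilU gQ; set P := generated_hypothesis (range g).
pose E v := objective Q U chi (fun x => (wealth g v x)%:E).
have feasible0 : feasible_set P g 0%R.
  split=> [i|]; first by rewrite mxE.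
  by apply: quasi_surely_all => x; rewrite -/(lincomb g 0 x) lincomb0 addr0.
pose S := [set objective Q U chi h' | h' in e_variable P].
have [|y Sy ycvg] := @ereal_sup_seq R S.
  apply/set0P; exists (E 0%R); exists (fun x => (wealth g 0 x)%:E) => //.
  exact: e_variable_wealth.
have ex n : exists v, K0 P g v /\ y n <= E v.
  have [h eh <-] := Sy n.
  have [v [v0 [Y qY hv]]] := e_variable_dominated mg eh.
  have fv : feasible_set P g v.
    split=> //; apply: quasi_surelyW qY; first exact: measurable_lincomb_lt.
    move=> x Yx; rewrite -/(lincomb g v x) -lee_fin.
    by apply: le_trans (hv x Yx); have [_ h0 _] := eh.
  have [w Kw wv] := feasible_reduction mg fv; exists w; split=> //.
  have hw : quasi_surely P (fun x => h x <= (1 + lincomb g w x)%:E).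
    have := quasi_surely_and qY wv; apply: quasi_surelyW.
      have [mh _ _] := eh.
      rewrite (_ : [set x | _] =
          ~` [set x | h x <= (1 + lincomb g w x)%:E]); last by [].
      apply: measurableC; rewrite -[X in measurable X]setTI.
      apply: measurable_lee => //; apply/measurable_EFinP.
      by apply: measurable_funD => //; exact: measurable_lincomb.
    by move=> x [Yx ->]; exact: hv.
  apply: le_ereal_inf_tmp => _ [mu Qmu <-].
  apply: (@le_trans _ _ (expected_utility U h mu - (chi mu)%:E)).
    by apply: ereal_inf_lbound; exists mu.
  rewrite expected_utility_wealth; apply: leeB => //.
  exact: (expected_utility_le mg utilU PQ eh Qmu hw).
have [u uP] := choice ex.
have [M KM] := K0_bounded mg.
have uM n i : (`|u n 0 i| <= M)%R.
  by rewrite ger0_norm ?KM//; [exact: (uP n).1|exact: (uP n).1.1.1].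
have [phi [p [phin up]]] := rV_bolzano_weierstrass uM.
have Kp : K0 P g p by apply: K0_closed up => // n; exact: (uP _).1.
exists (fun x => (wealth g p x)%:E), p; split=> //.
- by apply: e_variable_wealth => //; exact: Kp.2.
- have := wealth_quasi_surely Kp.2; congr (quasi_surely P _).
  by apply/funext => x; apply/propext; split=> [->//|[]].
apply/eqP; rewrite eq_le; apply/andP; split.
  apply: ereal_sup_ubound; exists (fun x => (wealth g p x)%:E) => //.
  by apply: e_variable_wealth => //; exact: Kp.2.
(* Testing against reals [c] below the supremum also covers an infinite supremum. *)
apply: le_ereal_real => c cS.
have [N _ yN] : \forall n \near \oo, c%:E <= y n.
  have : nbhs (ereal_sup S) [set z | c%:E < z].
    by apply: open_nbhs_nbhs; split=> //; exact: open_ereal_gt_ereal.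
  by move=> /ycvg[N _ yN]; exists N => // n /yN /ltW.
apply: le_ereal_inf_tmp => _ [mu Qmu <-].
rewrite expected_utility_wealth leeBrDr// -EFinD.
(* The shift by [N] gives every term an objective of at least [c], because [N <= phi (n + N)], and
   keeps the limit [p]. *)
apply: (expected_utility_usc mg utilU (u := fun n => u (phi (n + N)%N)) (M := M)).
- exact: gQ.
- by move=> n i; exact: uM.
- by move=> i; have := up i; rewrite -(cvg_shiftn N).
move=> n; rewrite EFinD -leeBrDr// -expected_utility_wealth.
have Nphi : (N <= phi (n + N))%N by apply: leq_trans (phin _); rewrite leq_addl.
apply: le_trans (yN _ Nphi) _; apply: le_trans (uP _).2 _.
by apply: ereal_inf_lbound; exists mu.
Qed.
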